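(* The categories $\mathbf{SS}_0$, $\mathbf{LatD}^{op}$ and $\mathbf{SpecD}$ are equivalent.
   Context: Foundations: ZFC with a universe; objects of the categories are structures on sets of that universe. The category $\mathbf{SS}_0$. A locally small space is a pair $(X,\mathcal{L}_X)$ with $X$ a set and $\mathcal{L}_X\subseteq\mathcal{P}(X)$ such that $\emptyset\in\mathcal{L}_X$, $A,B\in\mathcal{L}_X$ implies $A\cap B,A\cup B\in\mathcal{L}_X$, and $\bigcup\mathcal{L}_X=X$. It is a small space if $X\in\mathcal{L}_X$, and it is $T_0$ (Kolmogorov) if whenever $x,y\in X$ satisfy ($x\in A\iff y\in A$) for all $A\in\mathcal{L}_X$, then $x=y$. A mapping $f:X\to Y$ between locally small spaces is bounded if for each $A\in\mathcal{L}_X$ there is $B\in\mathcal{L}_Y$ with $A\subseteq f^{-1}(B)$, and continuous if $f^{-1}(B)\cap A\in\mathcal{L}_X$ for all $B\in\mathcal{L}_Y$, $A\in\mathcal{L}_X$. $\mathbf{SS}_0$ has the $T_0$ small spaces as objects and the bounded continuous mappings as morphisms (between small spaces boundedness is automatic). The category $\mathbf{SpecD}$. For a topological space $X$, $CO(X)$ denotes the family of compact (not necessarily Hausdorff) open subsets. A spectral space is a $T_0$, sober topological space $X$ such that $X\in CO(X)$, $CO(X)$ is a basis of the topology, and $CO(X)$ is closed under binary intersections; sober means that every open $W\neq X$ either is of the form $W=V_1\cap V_2$ with $V_1,V_2$ open and $W\ne V_1$, $W\neq V_2$, or equals $X\setminus\overline{\{x\}}$ for some $x\in X$. A mapping $g:X\to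 Y$ between spectral spaces is spectral if $g^{-1}(B)\in CO(X)$ for all $B\in CO(Y)$. An object of $\mathbf{SpecD}$ is a pair $((X,\tau_X),X_d)$ where $(X,\tau_X)$ is a spectral space and $X_d\subseteq X$ is a decent subset, i.e. for all $U,V\in CO(X)$, $U\neq V$ implies $U\cap X_d\neq V\cap X_d$. A morphism from $((X,\tau_X),X_d)$ to $((Y,\tau_Y),Y_d)$ is a spectral mapping $g:X\to Y$ with $g(X_d)\subseteq Y_d$. The category $\mathbf{LatD}$. For a bounded distributive lattice $L$, $\mathcal{PF}(L)$ is the set of all (proper) prime filters of $L$. For a homomorphism of bounded lattices $h:L\to M$ and $G\in\mathcal{PF}(M)$, $h^{\bullet}(G)=\{a\in L\mid h(a)\in G\}\in\mathcal{PF}(L)$. An object of $\mathbf{LatD}$ is a pair $(L,\mathbf{D}_L)$ with $L$ a bounded distributive lattice and $\mathbf{D}_L\subseteq\mathcal{PF}(L)$ (a decent set of prime filters on $L$) such that for all $a,b\in L$, $a\neq b$ implies $\{F\in\mathbf{D}_L\mid a\in F\}\neq\{F\in\mathbf{D}_L\mid b\in F\}$. A morphism from $(L,\mathbf{D}_L)$ to $(M,\mathbf{D}_M)$ is a homomorphism of bounded lattices $h:L\to M$ with $h^{\bullet}(\mathbf{D}_M)\subseteq\mathbf{D}_L$. In all three categories composition is composition of mappings; $^{op}$ denotes the opposite category. *)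

(* Defs.v *)
From HB Require Import structures.
From mathcomp Require Import all_boot all_order.
From mathcomp Require Import boolp classical_sets.
From mathcomp Require Import topology.

Set Implicit Arguments.
Unset Strict Implicit.
Unset Printing Implicit Defensive.

Local Open Scope classical_set_scope.

(** * Categories *)

Record category := Category {
  obj : Type;
  hom : obj -> obj -> Type;
  idm : forall A, hom A A;
  compm : forall A B C, hom B C -> hom A B -> hom A C;
  comp1m : forall A B (f : hom A B), compm (idm B) f = f;
  compm1 : forall A B (f : hom A B), compm f (idm A) = f;
  compmA : forall A B C D (h : hom C D) (g : hom B C) (f : hom A B),
    compm h (compm g f) = compm (compm h g) f }.

Arguments idm {c} A.
Arguments compm {c A B C} g f.

Definition opposite (C : category) : category :=
  @Category (obj C) (fun A B => @hom C B A) (fun A => idm A)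
    (fun A1 A2 A3 g f => compm f g)
    (fun A B f => compm1 f) (fun A B f => comp1m f)
    (fun A1 A2 A3 A4 h g f => esym (compmA f g h)).

Record functor (C D : category) := Functor {
  fobj :> obj C -> obj D;
  fmap : forall A B, hom A B -> hom (fobj A) (fobj B);
  fmap1 : forall A, fmap (idm A) = idm (fobj A);
  fmapM : forall A1 A2 A3 (g : hom A2 A3) (f : hom A1 A2),
    fmap (compm g f) = compm (fmap g) (fmap f) }.

Arguments fmap {C D} F {A B} f : rename.

Definition functor_id (C : category) : functor C C :=
  @Functor C C id (fun _ _ => id) (fun _ => erefl) (fun _ _ _ _ _ => erefl).

Lemma functor_comp1 (C D E : category) (G : functor D E) (F : functor C D) A :
  fmap G (fmap F (idm A)) = idm (G (F A)).
Proof. by rewrite !fmap1. Qed.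

Lemma functor_compM (C D E : category) (G : functor D E) (F : functor C D)
    A1 A2 A3 (g : hom A2 A3) (f : hom A1 A2) :
  fmap G (fmap F (compm g f)) =
  compm (fmap G (fmap F g)) (fmap G (fmap F f)).
Proof. by rewrite !fmapM. Qed.

Definition functor_comp (C D E : category) (G : functor D E)
    (F : functor C D) : functor C E :=
  Functor (functor_comp1 G F) (functor_compM G F).

Definition isomorphism (C : category) (A B : obj C) (f : hom A B) : Prop :=
  exists g : hom B A, compm g f = idm A /\ compm f g = idm B.

Definition naturally_isomorphic (C D : category) (F G : functor C D) : Prop :=
  exists eta : forall A, hom (F A) (G A),
    (forall A, isomorphism (eta A)) /\
    (forall A B (f : hom A B), compm (eta B) (fmap F f) =
                               compm (fmap G f) (eta A)).

Definition equivalent (C D : category) : Prop :=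
  exists (F : functor C D) (G : functor D C),
    naturally_isomorphic (functor_comp G F) (functor_id C) /\
    naturally_isomorphic (functor_comp F G) (functor_id D).

(* The category with objects [O], whose morphisms [A -> B] are the mappings
   [U A -> U B] satisfying [P A B], composed as mappings. *)
Section ConcreteCategory.
Variables (O : Type) (U : O -> Type) (P : forall A B : O, (U A -> U B) -> Prop).
Hypothesis P1 : forall A : O, P (@idfun (U A)).
Hypothesis PM : forall (A B C : O) (g : U B -> U C) (f : U A -> U B),
  P g -> P f -> P (g \o f).

Let chom (A B : O) := {f : U A -> U B | P f}.
Let cid A : chom A A := exist _ _ (P1 A).
Let ccomp A B C (g : chom B C) (f : chom A B) : chom A C :=
  exist _ _ (PM (proj2_sig g) (proj2_sig f)).

Let ccomp1 A B (f : chom A B) : ccomp (cid B) f = f.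
Proof. by case: f => f Pf; exact: eq_exist. Qed.

Let ccompr1 A B (f : chom A B) : ccomp f (cid A) = f.
Proof. by case: f => f Pf; exact: eq_exist. Qed.

Let ccompA A B C D (h : chom C D) (g : chom B C) (f : chom A B) :
  ccomp h (ccomp g f) = ccomp (ccomp h g) f.
Proof. exact: eq_exist. Qed.

Definition concrete_category : category := Category ccomp1 ccompr1 ccompA.

End ConcreteCategory.

(** * Kolmogorov small spaces *)

Record is_locally_small (X : Type) (L : set (set X)) : Prop := {
  smop0 : L set0;
  smopI : setI_closed L;
  smopU : setU_closed L;
  smop_cover : \bigcup_(A in L) A = setT }.

Definition is_small (X : Type) (L : set (set X)) : Prop :=
  is_locally_small L /\ L setT.

Definition is_T0_family (X : Type) (L : set (set X)) : Prop :=
  forall x y : X, (forall A, L A -> (A x <-> A y)) -> x = y.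

Definition bounded_map (X Y : Type) (LX : set (set X)) (LY : set (set Y))
    (f : X -> Y) : Prop :=
  forall A, LX A -> exists2 B, LY B & A `<=` f @^-1` B.

Definition continuous_map (X Y : Type) (LX : set (set X)) (LY : set (set Y))
    (f : X -> Y) : Prop :=
  forall A B, LX A -> LY B -> LX (f @^-1` B `&` A).

Record SS0_obj := SS0Obj {
  ss_sort :> Type;
  smop : set (set ss_sort);
  ss_small : is_small smop;
  ss_T0 : is_T0_family smop }.

Arguments smop : clear implicits.

Definition SS0_morph (X Y : SS0_obj) (f : X -> Y) : Prop :=
  bounded_map (smop X) (smop Y) f /\ continuous_map (smop X) (smop Y) f.

Lemma SS0_morph_id (X : SS0_obj) : SS0_morph (@idfun X).
Proof.
split=> [A LA | A B LA LB]; first by exists A.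
by case: (ss_small X) => -[_ LI _ _] _; exact: LI.
Qed.

Lemma SS0_morph_comp (X Y Z : SS0_obj) (g : Y -> Z) (f : X -> Y) :
  SS0_morph g -> SS0_morph f -> SS0_morph (g \o f).
Proof.
move=> [bg cg] [bf cf]; split=> [A LA | A C LA LC].
  have [B LB sAB] := bf _ LA; have [C LC sBC] := bg _ LB.
  by exists C => // x /sAB /sBC.
have [B LB sAB] := bf _ LA.
have := cf _ _ LA (cg _ _ LB LC); congr (smop X).
apply/seteqP; split=> x /= => [[[? ?] ?]|[? Ax]] //.
by split=> //; split=> //; exact: sAB.
Qed.

Definition SS0 : category := concrete_category SS0_morph_id SS0_morph_comp.

(** * Spectral spaces with a decent subset *)

Definition CO (X : topologicalType) : set (set X) :=
  [set U | open U /\ compact U].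
Arguments CO : clear implicits.

Definition is_sober (X : topologicalType) : Prop :=
  forall W : set X, open W -> W <> setT ->
    (exists V1 V2 : set X,
      [/\ open V1, open V2, W = V1 `&` V2, W <> V1 & W <> V2]) \/
    (exists x : X, W = ~` closure [set x]).

Record is_spectral (X : topologicalType) : Prop := {
  spectral_T0 : kolmogorov_space X;
  spectral_sober : is_sober X;
  spectral_CO_setT : CO X setT;
  spectral_CO_basis : basis (CO X);
  spectral_CO_setI : setI_closed (CO X) }.

Definition spectral_map (X Y : topologicalType) (g : X -> Y) : Prop :=
  forall B, CO Y B -> CO X (g @^-1` B).

Definition is_decent_subset (X : topologicalType) (Xd : set X) : Prop :=
  forall U V, CO X U -> CO X V -> U <> V -> U `&` Xd <> V `&` Xd.

Record SpecD_obj := SpecDObj {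
  sp_sort :> topologicalType;
  sp_spectral : is_spectral sp_sort;
  sp_dec : set sp_sort;
  sp_decent : is_decent_subset sp_dec }.

Arguments sp_dec : clear implicits.

Definition SpecD_morph (X Y : SpecD_obj) (g : X -> Y) : Prop :=
  spectral_map g /\ g @` sp_dec X `<=` sp_dec Y.

Lemma SpecD_morph_id (X : SpecD_obj) : SpecD_morph (@idfun X).
Proof. by split=> [B // | _ [x ? <-]]. Qed.

Lemma SpecD_morph_comp (X Y Z : SpecD_obj) (g : Y -> Z) (f : X -> Y) :
  SpecD_morph g -> SpecD_morph f -> SpecD_morph (g \o f).
Proof.
move=> [sg dg] [sf df]; split=> [C /sg /sf // | _ [x dx <-]].
by apply: dg; exists (f x) => //; apply: df; exists x.
Qed.

Definition SpecD : category := concrete_category SpecD_morph_id SpecD_morph_comp.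

(** * Bounded distributive lattices with a decent set of prime filters *)

Section PrimeFilters.
Import Order.Theory.
Local Open Scope order_scope.

Record is_prime_filter d (L : tbDistrLatticeType d) (F : set L) : Prop := {
  pf_top : F \top;
  pf_up : forall a b : L, a <= b -> F a -> F b;
  pf_meet : forall a b : L, F a -> F b -> F (a `&` b);
  pf_proper : F <> setT;
  pf_prime : forall a b : L, F (a `|` b) -> F a \/ F b }.

Definition PF d (L : tbDistrLatticeType d) : set (set L) :=
  [set F | is_prime_filter F].
Arguments PF {d} L.

Definition is_decent_family d (L : tbDistrLatticeType d) (D : set (set L)) :
    Prop :=
  D `<=` PF L /\
  forall a b : L, a <> b -> [set F | D F /\ F a] <> [set F | D F /\ F b].

(* Not [{tblmorphism L -> M}], which only asks for the preservation of [\bot]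
   and [\top]. *)
Record is_tbl_hom d (L : tbDistrLatticeType d) d' (M : tbDistrLatticeType d')
    (h : L -> M) : Prop := {
  tbl_hom_meet : Order.meet_morphism h;
  tbl_hom_join : Order.join_morphism h;
  tbl_hom_bot : h \bot = \bot;
  tbl_hom_top : h \top = \top }.

End PrimeFilters.

Definition bullet (L M : Type) (h : L -> M) (G : set M) : set L :=
  [set a | G (h a)].

Record LatD_obj := LatDObj {
  lat_disp : Order.disp_t;
  lat_sort :> tbDistrLatticeType lat_disp;
  lat_dec : set (set lat_sort);
  lat_decent : is_decent_family lat_dec }.

Arguments lat_dec : clear implicits.

Definition LatD_morph (L M : LatD_obj) (h : L -> M) : Prop :=
  is_tbl_hom h /\ bullet h @` lat_dec M `<=` lat_dec L.

Lemma LatD_morph_id (L : LatD_obj) : LatD_morph (@idfun L).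
Proof. by split=> [|_ [G ? <-]]; first by split=> //. Qed.

Lemma LatD_morph_comp (L M N : LatD_obj) (g : M -> N) (f : L -> M) :
  LatD_morph g -> LatD_morph f -> LatD_morph (g \o f).
Proof.
move=> [[gI gU g0 g1] dg] [[fI fU f0 f1] df]; split.
  split=> [a b|a b||] /=.
  - by rewrite fI gI.
  - by rewrite fU gU.
  - by rewrite f0.
  - by rewrite f1.
move=> _ [G dG <-]; apply: (df); exists (bullet g G) => //.
by apply: dg; exists G.
Qed.

Definition LatD : category := concrete_category LatD_morph_id LatD_morph_comp.

(* Main.v *)
From HB Require Import structures.
From mathcomp Require Import all_boot all_order.
From mathcomp Require Import boolp classical_sets.
From mathcomp Require Import topology.
Require Import Defs.

(** Both SS0 and SpecD consist of sets of points carrying a bounded sublattice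
of the powerset that separates points (the smops of a small space, the compact
open sets of a spectral space), with a subset of points large enough to
distinguish the members of the lattice (all the points, the decent subset).
Their morphisms are the mappings under which members of the lattice pull back
to members and distinguished points go to distinguished points.  Sending such
an object to its lattice, with the prime filters of the members that contain a
given distinguished point, and a mapping to its preimage operation, is
therefore one and the same construction of functors SS0 -> LatD^op and
SpecD -> LatD^op.  Each of them is fully faithful and essentially surjective,
hence an equivalence, and the third equivalence is a composite.

Full faithfulness ([lattice_functor_fully_faithful]): a lattice morphism h
comes from the mapping that sends x to the point y whose prime filter is
the pullback along h of the one of x.  Such a y is unique, points being
separated.  It exists in SS0 because every point is distinguished, and
morphisms of LatD pull distinguished filters back to distinguished ones; in
SpecD because every prime filter of compact open sets is the filter of a point,
which is where sobriety enters ([SpecD_prime_filter_point]).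

Essential surjectivity ([representation]): the sets of filters
{F | a \in F} form a lattice isomorphic to L, by decency, provided that the
filters range over a set that contains the distinguished ones.  Taking just the
distinguished filters gives a small space.  Taking all the prime filters gives
a space whose compact open sets are exactly the sets {F | a \in F}
([CO_spectrum]) and which is sober ([spectrum_sober]).  Compactness comes
from the remark that, for an ultrafilter on the set of prime filters, the a
such that {F | a \in F} is large form a prime filter, to which the ultrafilter
converges. *)

Set Implicit Arguments.
Unset Strict Implicit.
Unset Printing Implicit Defensive.

Import Order.Theory.

Local Open Scope classical_set_scope.

(** * Equivalences of categories *)

Lemma equivalent_sym (C D : category) : equivalent C D -> equivalent D C.
Proof. by move=> [F [G [? ?]]]; exists G, F. Qed.

Lemma isomorphism_comp (C : category) (X Y Z : obj C)
    (g : hom Y Z) (f : hom X Y) :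
  isomorphism g -> isomorphism f -> isomorphism (compm g f).
Proof.
move=> [g' [g'g gg']] [f' [f'f ff']]; exists (compm f' g'); split.
  by rewrite compmA -(compmA f') g'g compm1.
by rewrite compmA -(compmA g) ff' compm1.
Qed.

Lemma isomorphism_fmap (C D : category) (F : functor C D) (X Y : obj C)
    (f : hom X Y) :
  isomorphism f -> isomorphism (fmap F f).
Proof.
by move=> [g [gf fg]]; exists (fmap F g); rewrite -!fmapM gf fg !fmap1.
Qed.

Lemma naturally_isomorphic_comp_id (C D E : category)
    (F : functor C D) (G : functor D C) (F' : functor D E) (G' : functor E D) :
  naturally_isomorphic (functor_comp G F) (functor_id C) ->
  naturally_isomorphic (functor_comp G' F') (functor_id D) ->
  naturally_isomorphic (functor_comp (functor_comp G G') (functor_comp F' F))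
    (functor_id C).
Proof.
move=> [eta [eta_iso etaN]] [eps [eps_iso epsN]].
exists (fun A => compm (eta A) (fmap G (eps (F A)))); split=> [A | A B f].
  by apply: isomorphism_comp => //; exact: (isomorphism_fmap G (eps_iso _)).
have /= epsf := epsN _ _ (fmap F f); have /= etaf := etaN _ _ f.
by rewrite /= -compmA -fmapM epsf fmapM compmA etaf compmA.
Qed.

Lemma equivalent_trans (C D E : category) :
  equivalent C D -> equivalent D E -> equivalent C E.
Proof.
move=> [F [G [GF FG]]] [F' [G' [GF' FG']]].
exists (functor_comp F' F), (functor_comp G G').
by split; exact: naturally_isomorphic_comp_id.
Qed.

Definition fully_faithful (C D : category) (F : functor C D) : Prop :=
  forall (A B : obj C) (g : hom (F A) (F B)), exists! f : hom A B, fmap F f = g.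

Definition essentially_surjective (C D : category) (F : functor C D) : Prop :=
  forall B : obj D, exists (A : obj C) (e : hom (F A) B), isomorphism e.

Section FullyFaithful.
Variables (C D : category) (F : functor C D).
Hypotheses (Fff : fully_faithful F) (Fes : essentially_surjective F).

Let pre (A B : obj C) (g : hom (F A) (F B)) : hom A B := projT1 (cid (Fff g)).

Let preK (A B : obj C) (g : hom (F A) (F B)) : fmap F (pre g) = g.
Proof. by have [] := projT2 (cid (Fff g)). Qed.

Let fmap_inj (A B : obj C) (f f' : hom A B) : fmap F f = fmap F f' -> f = f'.
Proof. by have [f0 [_ f0P]] := Fff (fmap F f') => /f0P <-; apply: f0P. Qed.

Let invo (B : obj D) : obj C := projT1 (cid (Fes B)).

Let cou (B : obj D) : hom (F (invo B)) B := projT1 (cid (projT2 (cid (Fes B)))).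

Let cou_iso (B : obj D) : isomorphism (cou B).
Proof. exact: projT2 (cid (projT2 (cid (Fes B)))). Qed.

Let coui (B : obj D) : hom B (F (invo B)) := projT1 (cid (cou_iso B)).

Let couK (B : obj D) : compm (coui B) (cou B) = idm _.
Proof. by have [] := projT2 (cid (cou_iso B)). Qed.

Let couiK (B : obj D) : compm (cou B) (coui B) = idm _.
Proof. by have [] := projT2 (cid (cou_iso B)). Qed.

Let invm (B B' : obj D) (g : hom B B') : hom (invo B) (invo B') :=
  pre (compm (coui B') (compm g (cou B))).

Let invm1 (B : obj D) : invm (idm B) = idm (invo B).
Proof. by apply: fmap_inj; rewrite preK comp1m couK fmap1. Qed.

Let invmM (B1 B2 B3 : obj D) (g : hom B2 B3) (f : hom B1 B2) :
  invm (compm g f) = compm (invm g) (invm f).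
Proof.
apply: fmap_inj; rewrite fmapM !preK -!compmA; congr compm; congr compm.
by rewrite [RHS]compmA couiK comp1m.
Qed.

(** The quasi-inverse picks for each object B an object whose image is
isomorphic to B; everything else is forced, because morphisms may be compared
after applying F. *)
Lemma fully_faithful_equivalent : equivalent C D.
Proof.
exists F, (Functor invm1 invmM); split.
  exists (fun A => pre (cou (F A))); split=> [A | A B f].
    exists (pre (coui (F A))).
    by split; apply: fmap_inj; rewrite fmapM !preK fmap1 ?couK ?couiK.
  by apply: fmap_inj; rewrite /= !fmapM !preK compmA couiK comp1m.
exists cou; split=> [B | B B' g]; first exact: cou_iso.
by rewrite /= preK compmA couiK comp1m.
Qed.

End FullyFaithful.

(** * Rings of sets with decent points and their lattices *)

(** The common shape of the objects of SS0 and SpecD: [ring] is the family of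
smops, resp. of compact open sets, and [dec] the set of all points, resp. the
decent subset. *)
Record decent_ring := DecentRing {
  pts : Type;
  ring : set (set pts);
  dec : set pts;
  ring0 : ring set0;
  ringT : ring setT;
  ringI : setI_closed ring;
  ringU : setU_closed ring;
  ring_separates : is_T0_family ring;
  ring_decent : forall U V,
    ring U -> ring V -> U `&` dec = V `&` dec -> U = V }.

Arguments ring : clear implicits.
Arguments dec : clear implicits.

Section RingLattice.
Local Open Scope order_scope.
Variable R : decent_ring.

Definition ring_elt : Type := {A : set (pts R) | ring R A}.

HB.instance Definition _ := gen_eqMixin ring_elt.
HB.instance Definition _ := gen_choiceMixin ring_elt.

Lemma ring_elt_inj (A B : ring_elt) : sval A = sval B -> A = B.
Proof. by case: A B => A RA [B RB] /= eAB; exact: eq_exist. Qed.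

Let meetr (A B : ring_elt) : ring_elt :=
  exist _ _ (ringI (proj2_sig A) (proj2_sig B)).
Let joinr (A B : ring_elt) : ring_elt :=
  exist _ _ (ringU (proj2_sig A) (proj2_sig B)).
Let ler (A B : ring_elt) : bool := meetr A B == A.
Let ltr (A B : ring_elt) : bool := (B != A) && ler A B.

Fact meetrC : commutative meetr.
Proof. by move=> A B; apply: ring_elt_inj; exact: setIC. Qed.
Fact joinrC : commutative joinr.
Proof. by move=> A B; apply: ring_elt_inj; exact: setUC. Qed.
Fact meetrA : associative meetr.
Proof. by move=> A B C; apply: ring_elt_inj; exact: setIA. Qed.
Fact joinrA : associative joinr.
Proof. by move=> A B C; apply: ring_elt_inj; exact: setUA. Qed.
Fact joinrKI (B A : ring_elt) : meetr A (joinr A B) = A.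
Proof. by apply: ring_elt_inj; rewrite /= setUC setKU. Qed.
Fact meetrKU (B A : ring_elt) : joinr A (meetr A B) = A.
Proof. by apply: ring_elt_inj; rewrite /= setIC setKI. Qed.
Fact meetrUl : left_distributive meetr joinr.
Proof. by move=> A B C; apply: ring_elt_inj; exact: setIUl. Qed.
Fact meetrr : idempotent_op meetr.
Proof. by move=> A; apply: ring_elt_inj; exact: setIid. Qed.

HB.instance Definition _ :=
  Order.isMeetJoinDistrLattice.Build (Order.Disp tt tt) ring_elt
    (fun _ _ => erefl) (fun _ _ => erefl) meetrC joinrC meetrA joinrA
    joinrKI meetrKU meetrUl meetrr.

(** The order is defined from the meet; this recovers inclusion. *)
Lemma ring_leP (A B : ring_elt) : reflect (sval A `<=` sval B) (A <= B).
Proof.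
apply: (iffP eqP) => [<- x [] // | sAB].
by apply: ring_elt_inj; exact/setIidPl.
Qed.

Let botr : ring_elt := exist _ _ (ring0 R).
Let topr : ring_elt := exist _ _ (ringT R).

Fact le0r (A : ring_elt) : botr <= A.
Proof. by apply/ring_leP. Qed.
Fact ler1 (A : ring_elt) : A <= topr.
Proof. by apply/ring_leP. Qed.

HB.instance Definition _ := Order.hasBottom.Build _ ring_elt le0r.
HB.instance Definition _ := Order.hasTop.Build _ ring_elt ler1.

Definition point_filter (x : pts R) : set ring_elt := [set A | sval A x].

Lemma point_filter_prime x : is_prime_filter (point_filter x).
Proof.
split=> [|A B /ring_leP sAB|A B|FT|A B] //; first exact: sAB.
by have : point_filter x \bot by rewrite FT.
Qed.

Lemma point_filter_inj : injective point_filter.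
Proof.
move=> x y exy; apply: ring_separates => A RA.
have /= := congr1 (fun F : set ring_elt => F (exist _ A RA)) exy.
by rewrite /point_filter/= => ->.
Qed.

Definition point_filters : set (set ring_elt) := point_filter @` dec R.

(** A member A of the ring is recovered from the filters that contain it, since
the filter of x contains A exactly when x is in A, and from its distinguished
points by [ring_decent]. *)
Lemma point_filters_decent : is_decent_family point_filters.
Proof.
split=> [_ [x _ <-] | A B neAB eAB]; first exact: point_filter_prime.
apply: neAB; apply: ring_elt_inj; apply: ring_decent; try exact: proj2_sig.
have H (U V : ring_elt) x :
    [set F | point_filters F /\ F U] = [set F | point_filters F /\ F V] ->
    sval U x -> dec R x -> sval V x.
  move=> eUV Ux dx; have : [set F | point_filters F /\ F V] (point_filter x).
    by rewrite -eUV; split=> //; exists x.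
  by case.
by apply/seteqP; split=> x [Ax dx]; split=> //; apply: H Ax dx.
Qed.

Definition ring_lattice : LatD_obj := LatDObj point_filters_decent.

End RingLattice.

Arguments point_filter : clear implicits.

(** * The functor to the opposite of LatD *)

Section LatticeFunctor.
Variables (O : Type) (S : O -> decent_ring).
Variable P : forall A B : O, (pts (S A) -> pts (S B)) -> Prop.
Hypothesis P1 : forall A : O, P (@idfun (pts (S A))).
Hypothesis PM : forall (A B C : O) (g : pts (S B) -> pts (S C))
  (f : pts (S A) -> pts (S B)), P g -> P f -> P (g \o f).
Hypothesis PE : forall (A B : O) (f : pts (S A) -> pts (S B)),
  P f <-> (forall V, ring (S B) V -> ring (S A) (f @^-1` V)) /\
          f @` dec (S A) `<=` dec (S B).

Let C : category := concrete_category P1 PM.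

Definition preimage_elt (A B : O) (f : {f : pts (S A) -> pts (S B) | P f}) :
    ring_elt (S B) -> ring_elt (S A) :=
  fun V => exist _ (sval f @^-1` sval V)
    ((iffLR (PE (sval f)) (proj2_sig f)).1 _ (proj2_sig V)).

Lemma preimage_elt_morph (A B : O) (f : {f : pts (S A) -> pts (S B) | P f}) :
  @LatD_morph (ring_lattice (S B)) (ring_lattice (S A)) (preimage_elt f).
Proof.
split; first by split=> [U V|U V||]; exact: ring_elt_inj.
move=> _ [_ [x dx <-] <-]; exists (sval f x) => //.
by apply: (iffLR (PE _) (proj2_sig f)).2; exists x.
Qed.

Let fobj (A : O) : obj (opposite LatD) := ring_lattice (S A).

Let ffun (A B : O) (f : @hom C A B) : @hom (opposite LatD) (fobj A) (fobj B) :=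
  exist _ _ (preimage_elt_morph f).

Let ffun1 (A : obj C) : ffun (@idm C A) = idm (fobj A).
Proof. by apply: eq_exist; apply: funext => V; exact: ring_elt_inj. Qed.

Let ffunM (A1 A2 A3 : obj C) (g : @hom C A2 A3) (f : @hom C A1 A2) :
  ffun (compm g f) = compm (ffun g) (ffun f).
Proof. by apply: eq_exist; apply: funext => V; exact: ring_elt_inj. Qed.

Definition lattice_functor : functor C (opposite LatD) := Functor ffun1 ffunM.

Hypothesis pullback_point : forall (A B : O)
  (h : ring_elt (S B) -> ring_elt (S A)),
  @LatD_morph (ring_lattice (S B)) (ring_lattice (S A)) h ->
  forall x, exists y, bullet h (point_filter (S A) x) = point_filter (S B) y.

(** The mapping underlying a lattice morphism is read off from the action of
the latter on the filters of points; [point_filter_inj] makes it unique. *)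
Lemma lattice_functor_fully_faithful : fully_faithful lattice_functor.
Proof.
move=> A B [h hM]; pose f x := projT1 (cid (pullback_point hM x)).
have fE x : bullet h (point_filter (S A) x) = point_filter (S B) (f x).
  exact: projT2 (cid (pullback_point hM x)).
have f_pre V : sval (h V) = f @^-1` sval V.
  by apply: funext => x; have := congr1 (fun F => F V) (fE x).
have Pf : P f.
  apply/PE; split=> [V RV | _ [x dx <-]].
    by have := f_pre (exist _ V RV) => /= <-; exact: proj2_sig.
  have [|y dy eyx] := hM.2 (bullet h (point_filter (S A) x)).
    by exists (point_filter _ x) => //; exists x.
  by rewrite -(point_filter_inj (etrans eyx (fE x))).
exists (exist _ f Pf); split=> [|[g Pg] /(congr1 sval) /= gh].
  by apply: eq_exist; apply: funext => V; apply: ring_elt_inj; rewrite f_pre.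
apply: eq_exist; apply: funext => x; apply: point_filter_inj.
by rewrite -fE -gh.
Qed.

End LatticeFunctor.

(** * Representation of lattices by sets of prime filters *)

(** Bijectivity does not suffice in LatD: the inverse must also pull
distinguished filters back to distinguished ones, whence the last hypothesis. *)
Lemma LatD_bijective_isomorphism (L M : LatD_obj) (h : L -> M)
    (hM : LatD_morph h) :
  injective h -> (forall b, exists a, h a = b) ->
  (forall F, lat_dec L F -> exists2 G, lat_dec M G & F = bullet h G) ->
  @isomorphism (opposite LatD) M L (exist _ h hM).
Proof.
move=> hinj /choice[g gK] hdec.
have hK : cancel h g by move=> a; apply: hinj; rewrite gK.
have gM : LatD_morph g.
  case: (hM) => -[hI hU h0 h1] _; split.
    split=> [a b|a b||]; apply: hinj.
    - by rewrite hI !gK.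
    - by rewrite hU !gK.
    - by rewrite h0 gK.
    - by rewrite h1 gK.
  move=> _ [F /hdec [G dG ->] <-].
  suff -> : bullet g (bullet h G) = G by [].
  by apply/seteqP; split=> b; rewrite /bullet/= gK.
by exists (exist _ g gM); split; apply: eq_exist; apply: funext.
Qed.

(** The prime filters are indexed by a type [T], so that the same lemmas serve
for the distinguished filters and for the whole spectrum. *)
Section PrimeFilterFamily.
Local Open Scope order_scope.
Context d (L : tbDistrLatticeType d) (T : Type) (ev : T -> set L).
Hypothesis ev_prime : forall x, is_prime_filter (ev x).

Definition hat (a : L) : set T := [set x | ev x a].

Lemma hat0 : hat \bot = set0.
Proof.
apply/seteqP; split=> // x ev0; apply: (pf_proper (ev_prime x)).
by apply/seteqP; split=> // a _; apply: pf_up (le0x a) ev0.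
Qed.

Lemma hatT : hat \top = setT.
Proof. by apply/seteqP; split=> // x _; exact: pf_top. Qed.

Lemma hatI (a b : L) : hat (a `&` b) = (hat a `&` hat b)%classic.
Proof.
apply/seteqP; split=> x => [eab | [ea eb]]; last exact: pf_meet.
by split; apply: pf_up eab => //; rewrite ?leIl ?leIr.
Qed.

Lemma hatU (a b : L) : hat (a `|` b) = (hat a `|` hat b)%classic.
Proof.
apply/seteqP; split=> x => [eab | [] e]; first exact: pf_prime.
  by apply: pf_up e => //; exact: leUl.
by apply: pf_up e => //; exact: leUr.
Qed.

Lemma range_hat0 : range hat set0.
Proof. by exists \bot => //; exact: hat0. Qed.

Lemma range_hatT : range hat setT.
Proof. by exists \top => //; exact: hatT. Qed.

Lemma range_hatI : setI_closed (range hat).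
Proof.
by move=> _ _ [a _ <-] [b _ <-]; exists (a `&` b) => //; exact: hatI.
Qed.

Lemma range_hatU : setU_closed (range hat).
Proof.
by move=> _ _ [a _ <-] [b _ <-]; exists (a `|` b) => //; exact: hatU.
Qed.

Lemma range_hat_T0 : injective ev -> is_T0_family (range hat).
Proof.
move=> ev_inj x y exy; apply: ev_inj; apply/seteqP; split=> a.
  by apply: (exy (hat a) _).1; exists a.
by apply: (exy (hat a) _).2; exists a.
Qed.

End PrimeFilterFamily.

(** Decency of L, transported to the points: a member of the ring determines
its element of L already by its distinguished points. *)
Lemma hat_decent_inj (L : LatD_obj) (T : Type) (ev : T -> set L) (D : set T)
    (a b : L) :
  ev @` D = lat_dec L -> hat ev a `&` D = hat ev b `&` D -> a = b.
Proof.
move=> evD eab; apply: contrapT => /(lat_decent L).2; apply.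
have eE x : D x -> ev x a = ev x b.
  move=> Dx; have := congr1 (fun A : set T => A x) eab.
  rewrite /hat /setI /= => exab.
  by apply/propext; split=> e; [have : (ev x a /\ D x) by []; rewrite exab |
     have : (ev x b /\ D x) by []; rewrite -exab]; case.
rewrite -evD; apply/seteqP.
by split=> _ [[x Dx <-] Fx]; (split; first by exists x); rewrite /= ?eE // -eE.
Qed.

Lemma bullet_prime d (L : tbDistrLatticeType d) d' (M : tbDistrLatticeType d')
    (h : L -> M) (G : set M) :
  is_tbl_hom h -> is_prime_filter G -> is_prime_filter (bullet h G).
Proof.
move=> [hI hU h0 h1] [GT Gup GI GP GU]; rewrite /bullet.
split=> [|a b ab|a b Ga Gb|GhT|a b] /=.
- by rewrite h1.
- by apply: Gup; move: ab; rewrite !leEmeet -hI => /eqP ->.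
- by rewrite hI; exact: GI.
- have : bullet h G \bot%O by rewrite /bullet GhT.
  rewrite /bullet /= h0 => G0; apply: GP; apply/seteqP; split=> // b _.
  by apply: Gup G0; exact: le0x.
- by rewrite hU; exact: GU.
Qed.

Section Representation.
Variables (R : decent_ring) (L : LatD_obj) (ev : pts R -> set L).
Hypothesis ev_prime : forall x, is_prime_filter (ev x).
Hypothesis ev_ring : ring R = range (hat ev).
Hypothesis ev_dec : ev @` dec R = lat_dec L.

Let hat_elt (a : L) : ring_elt R.
Proof. by exists (hat ev a); rewrite ev_ring; exists a. Defined.

Let hat_elt_morph : @LatD_morph L (ring_lattice R) hat_elt.
Proof.
split; last first.
  by move=> _ [_ [x dx <-] <-]; rewrite -ev_dec; exists x.
split=> [a b|a b||]; apply: ring_elt_inj.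
- exact: hatI.
- exact: hatU.
- exact: hat0.
- exact: hatT.
Qed.

(** An element a is sent to the set of points whose filter contains it.  This
is onto by [ev_ring], injective by decency, and matches distinguished filters
by [ev_dec]. *)
Lemma representation :
  exists e : @hom (opposite LatD) (ring_lattice R) L, isomorphism e.
Proof.
exists (exist _ _ hat_elt_morph); apply: LatD_bijective_isomorphism.
- move=> a b /(congr1 sval)/= eab.
  by apply: (hat_decent_inj ev_dec); rewrite eab.
- move=> [A RA]; have : range (hat ev) A by rewrite -ev_ring.
  by move=> [a _ ea]; exists a; exact: ring_elt_inj.
- move=> F; rewrite -ev_dec => -[x dx <-].
  by exists (point_filter R x) => //; exists x.
Qed.

End Representation.

(** * Small spaces *)

Fact SS0_decent (X : SS0_obj) U V :
  smop X U -> smop X V -> U `&` setT = V `&` setT -> U = V.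
Proof. by rewrite !setIT. Qed.

Definition SS0_ring (X : SS0_obj) : decent_ring :=
  DecentRing (smop0 (ss_small X).1) (ss_small X).2 (smopI (ss_small X).1)
    (smopU (ss_small X).1) (@ss_T0 X) (@SS0_decent X).

(** As the whole space is a smop, boundedness is automatic and continuity
amounts to preimages of smops being smops.  The condition on [setT] is the one
on distinguished points. *)
Fact SS0_morphE (X Y : SS0_obj) (f : X -> Y) :
  SS0_morph f <-> (forall V, smop Y V -> smop X (f @^-1` V)) /\
                  f @` setT `<=` setT.
Proof.
split=> [[_ cf] | [cf _]].
  split=> // V LV; rewrite -[_ @^-1` _]setIT.
  by apply: cf => //; exact: (ss_small X).2.
split=> [A LA | A B LA LB]; first by exists setT => //; exact: (ss_small Y).2.
by apply: (smopI (ss_small X).1) => //; exact: cf.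
Qed.

Theorem SS0_LatD : equivalent SS0 (opposite LatD).
Proof.
apply: (@fully_faithful_equivalent _ _
  (lattice_functor (S := SS0_ring) SS0_morph_id SS0_morph_comp SS0_morphE)).
  apply: lattice_functor_fully_faithful => X Y h [_ hdec] x.
  have [|y _ <-] := hdec (bullet h (point_filter (SS0_ring X) x)).
    by exists (point_filter (SS0_ring X) x) => //; exists x.
  by exists y.
move=> L; pose X := {F : set L | lat_dec L F}; pose ev (F : X) := sval F.
have ev_prime F : is_prime_filter (ev F).
  by apply: (lat_decent L).1; exact: proj2_sig.
have ev_inj : injective ev by move=> [F dF] [G dG] /= eFG; exact: eq_exist.
have smallX : is_small (range (hat ev)).
  split; last exact: range_hatT.
  split; [exact: range_hat0 | exact: range_hatI | exact: range_hatU |].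
  by apply/seteqP; split=> // F _; exists setT => //; exact: range_hatT.
pose XL := SS0Obj smallX (range_hat_T0 ev_inj).
exists XL; apply: (@representation (SS0_ring XL) L ev) => //.
apply/seteqP; split=> [_ [F _ <-] | F dF]; first exact: proj2_sig.
by exists (exist _ F dF).
Qed.

(** * The spectrum of a distributive lattice *)

(** Otherwise the sets K minus U, for U in I, would generate a proper filter
with no cluster point in K: a point of K lies in some U of I, which is a
neighbourhood of it disjoint from K minus U. *)
Lemma compact_directed_cover (X : topologicalType) (K : set X)
    (I : set (set X)) :
  compact K -> I `<=` open -> I set0 -> setU_closed I ->
  K `<=` \bigcup_(U in I) U -> exists2 U, I U & K `<=` U.
Proof.
move=> cK Iop I0 IU KI; apply: contrapT => nK.
pose F : set_system X := [set A | exists2 U, I U & K `\` U `<=` A].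
have FF : ProperFilter F.
  apply: Build_ProperFilter_ex => [A [U IUU sA] | ].
    apply: contrapT => nA; apply: nK; exists U => // x Kx.
    by apply: contrapT => nUx; apply: nA; exists x; apply: sA.
  split=> [|A B [U IUU sA] [V IV sB]|A B sAB [U IUU sA]].
  - by exists set0.
  - exists (U `|` V); first exact: IU.
    by move=> x [Kx /not_orP[nU nV]]; split; [apply: sA|apply: sB].
  - by exists U => //; apply: subset_trans sAB.
have [x [Kx Fx]] : K `&` cluster F !=set0.
  by apply: cK; exists set0 => // x [].
have [U IUU Ux] := KI x Kx.
have [||y [[_ nUy] Uy]] := Fx (K `\` U) U; first by exists U.
  by apply: open_nbhs_nbhs; split=> //; exact: Iop.
exact: nUy.
Qed.

Section Spectrum.
Local Open Scope order_scope.
Context d (L : tbDistrLatticeType d).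

Definition spectrum : Type := {F : set L | is_prime_filter F}.

HB.instance Definition _ := gen_eqMixin spectrum.
HB.instance Definition _ := gen_choiceMixin spectrum.

Definition spec_ev (F : spectrum) : set L := sval F.

Lemma spec_ev_prime F : is_prime_filter (spec_ev F).
Proof. exact: proj2_sig. Qed.

Lemma spec_ev_inj : injective spec_ev.
Proof. by move=> [F pF] [G pG] /= eFG; exact: eq_exist. Qed.

Let hat := hat spec_ev.

Definition spec_open : set (set spectrum) :=
  [set W | forall F, W F -> exists2 a, hat a F & hat a `<=` W].

Fact spec_openT : spec_open setT.
Proof. by move=> F _; exists \top => //; exact: pf_top (spec_ev_prime F). Qed.

Fact spec_openI : setI_closed spec_open.
Proof.
move=> V W Vop Wop F [/Vop[a aF aV] /Wop[b bF bW]]; exists (a `&` b).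
  by rewrite /hat hatI //; exact: spec_ev_prime.
rewrite /hat hatI; first by move=> G [/aV ? /bW ?].
exact: spec_ev_prime.
Qed.

Fact spec_open_bigU (I : Type) (f : I -> set spectrum) :
  (forall i, spec_open (f i)) -> spec_open (\bigcup_i f i).
Proof.
by move=> fop F [i _ /fop[a aF af]]; exists a => // G /af; exists i.
Qed.

HB.instance Definition _ :=
  isOpenTopological.Build spectrum spec_openT spec_openI spec_open_bigU.

Lemma hat_open a : open (hat a).
Proof. by move=> F aF; exists a. Qed.

Lemma spec_nbhsE (F : spectrum) (A : set spectrum) :
  nbhs F A <-> exists2 a, hat a F & hat a `<=` A.
Proof.
split=> [[W [Wop WF sWA]] | [a aF sA]].
  by have [a aF sW] := Wop F WF; exists a => //; exact: subset_trans sWA.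
by exists (hat a); split=> //; exact: hat_open.
Qed.

(** The elements whose hat is large for an ultrafilter form a prime filter,
primeness being the ultrafilter alternative; it is a limit point. *)
Lemma hat_compact a : compact (hat a).
Proof.
rewrite compact_ultra => U UU Ua.
have pU : is_prime_filter [set b | U (hat b)].
  split=> /=.
  - by rewrite /hat hatT; [exact: filterT | exact: spec_ev_prime].
  - move=> b c bc; apply: filterS => F; apply: pf_up bc.
    exact: spec_ev_prime.
  - move=> b c Ub Uc; rewrite /hat hatI; first exact: filterI.
    exact: spec_ev_prime.
  - move=> UT; have : [set b | U (hat b)] \bot by rewrite UT.
    rewrite /= /hat hat0; last exact: spec_ev_prime.
    exact: filter_not_empty.
  - move=> b c Ubc; have [|nUb] := in_ultra_setVsetC (hat b) UU; first by left.
    right; apply: filterS (filterI Ubc nUb) => F [].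
    by rewrite /hat hatU; [case | exact: spec_ev_prime].
exists (exist _ _ pU); split=> // A /spec_nbhsE[b Ub sA].
exact: filterS sA Ub.
Qed.

(** A compact open W is covered by the hats contained in it, which are directed,
so it is contained in one of them. *)
Lemma CO_spectrum : CO spectrum = range hat.
Proof.
apply/seteqP; split=> [W [Wop cW] | _ [a _ <-]]; last first.
  by split; [exact: hat_open | exact: hat_compact].
have [||||_ [[a _ <-] aW] Wa] :=
    compact_directed_cover (I := [set V | range hat V /\ V `<=` W]) cW.
- by move=> _ [[a _ <-] _]; exact: hat_open.
- by split=> //; apply: range_hat0; exact: spec_ev_prime.
- move=> A B [rA sA] [rB sB]; split; last by rewrite subUset.
  by apply: range_hatU => //; exact: spec_ev_prime.
- by move=> F /Wop[a aF aW]; exists (hat a) => //; split=> //; exists a.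
by exists a => //; apply/seteqP.
Qed.

Lemma spectrum_T0 : kolmogorov_space spectrum.
Proof.
move=> F G /eqP neFG; apply: contrapT => nsep; apply: neFG; apply: spec_ev_inj.
have H (F' G' : spectrum) a : ~ (exists A : set spectrum,
    A \in nbhs F' /\ G' \in ~` A) -> spec_ev F' a -> spec_ev G' a.
  move=> nA aF; apply: contrapT => aG; apply: nA; exists (hat a).
  split; rewrite inE //; apply/spec_nbhsE; exists a => //.
by apply/seteqP; split=> a; apply: H => -[A ?]; apply: nsep; exists A;
  [left|right].
Qed.

(** If W is not an intersection of two larger open sets, the elements whose
hat is not contained in W form a prime filter, irreducibility giving closure
under meets; the closure of that point is the complement of W. *)
Lemma spectrum_sober : is_sober spectrum.
Proof.
move=> W Wop WT; apply: contrapT => /not_orP[irrW npt]; apply: npt.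
have pW : is_prime_filter [set a | ~ (hat a `<=` W)].
  split=> /=.
  - rewrite /hat hatT; last exact: spec_ev_prime.
    by move=> TW; apply: WT; apply/seteqP.
  - move=> a b ab aW bW; apply: aW => F aF; apply: bW.
    by apply: pf_up ab aF; exact: spec_ev_prime.
  - move=> a b aW bW; rewrite /hat hatI; last exact: spec_ev_prime.
    move=> abW; apply: irrW; exists (W `|` hat a), (W `|` hat b); split.
    + by apply: openU => //; exact: hat_open.
    + by apply: openU => //; exact: hat_open.
    + by rewrite -setUIr setUidl.
    + by move=> eW; apply: aW; rewrite eW; exact: subsetUr.
    + by move=> eW; apply: bW; rewrite eW; exact: subsetUr.
  - move=> eT; have : [set a | ~ (hat a `<=` W)] \bot by rewrite eT.
    by apply; rewrite /hat hat0 //; exact: spec_ev_prime.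
  - move=> a b; rewrite /hat hatU; last exact: spec_ev_prime.
    by rewrite subUset => /not_andP.
exists (exist _ _ pW); apply/seteqP; split=> G.
  move=> /Wop[a aG aW] /(_ (hat a)) []; first by apply/spec_nbhsE; exists a.
  by move=> _ [->].
move=> nclG; apply: contrapT => nWG; apply: nclG => A /spec_nbhsE[a aG sA].
exists (exist _ _ pW); split=> //; apply: sA.
by move=> /(_ G aG).
Qed.

Lemma spectrum_spectral : is_spectral spectrum.
Proof.
split; rewrite ?CO_spectrum.
- exact: spectrum_T0.
- exact: spectrum_sober.
- by apply: range_hatT; exact: spec_ev_prime.
- split=> [_ [a _ <-] | F A /spec_nbhsE[a aF sA]]; first exact: hat_open.
  by exists (hat a) => //; split=> //; exists a.
- by apply: range_hatI; exact: spec_ev_prime.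
Qed.

End Spectrum.

(** * Spectral spaces *)

Fact CO_set0 (X : topologicalType) : CO X set0.
Proof. by split; [exact: open0 | exact: compact0]. Qed.

Fact CO_setU (X : topologicalType) : setU_closed (CO X).
Proof.
by move=> U V [Uop cU] [Vop cV]; split; [exact: openU | exact: compactU].
Qed.

Fact CO_separates (X : topologicalType) : is_spectral X -> is_T0_family (CO X).
Proof.
move=> [T0 _ _ [_ base] _] x y exy; apply: contrapT => /eqP/T0[A].
rewrite !inE; case=> -[/base[U [COU Ux] sU]] nA; apply: nA; apply: sU.
  exact/(exy U COU).
exact/(exy U COU).
Qed.

Fact SpecD_decent (X : SpecD_obj) U V : CO X U -> CO X V ->
  U `&` sp_dec X = V `&` sp_dec X -> U = V.
Proof. by move=> ? ? ?; apply: contrapT => /(sp_decent (s:=X)); apply. Qed.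

Definition SpecD_ring (X : SpecD_obj) : decent_ring :=
  DecentRing (CO_set0 X) (spectral_CO_setT (sp_spectral X))
    (spectral_CO_setI (sp_spectral X)) (@CO_setU X)
    (CO_separates (sp_spectral X)) (@SpecD_decent X).

(** Let W be the union of the members of the ring outside F.  By compactness
and primeness, no member of F is contained in W; hence W is a proper
open set, and it is irreducible because F is closed under meets.  Sobriety
writes W as the complement of the closure of a point x, and a compact open
set is in F iff it is not contained in W iff it contains x. *)
Lemma SpecD_prime_filter_point (X : SpecD_obj)
    (F : set (ring_elt (SpecD_ring X))) :
  is_prime_filter F -> exists x, F = point_filter (SpecD_ring X) x.
Proof.
move=> [FT Fup FI FP FU]; have [_ sob COT [_ base] COI] := sp_spectral X.
pose E := ring_elt (SpecD_ring X).
have F0 : ~ F \bot%O.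
  move=> F0; apply: FP; apply/seteqP; split=> // V _.
  by apply: Fup F0; exact: le0x.
pose I : set (set X) := [set U | exists2 V : E, sval V = U & ~ F V].
pose W := \bigcup_(U in I) U.
have Iop : I `<=` open by move=> _ [V <- _]; exact: (proj2_sig V).1.
have Wop : open W by exact: bigcup_open.
have sWP (V : E) : sval V `<=` W -> ~ F V.
  move=> VW FV.
  have [||V' [V1 <- nF1] sV] :=
    compact_directed_cover (proj2_sig V).2 Iop _ _ VW.
  - by exists \bot%O.
  - move=> _ _ [V1 <- n1] [V2 <- n2]; exists (V1 `|` V2)%O => // /FU[] //.
  by apply: nF1; apply: Fup FV; apply/ring_leP.
have WT : W <> setT by move=> eT; apply: (sWP \top%O) => //; rewrite eT.
(* The compact open sets contained in V cover it; if none were in F, all of them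
   would be among those whose union is W. *)
have larger (V : set X) : open V -> W `<=` V -> W <> V ->
    exists2 U : E, sval U `<=` V & F U.
  move=> Vop WV neW; apply: contrapT => nU; apply: neW; apply/seteqP.
  split=> // x Vx.
  have [U [COU Ux] UV] := base x V (open_nbhs_nbhs (conj Vop Vx)).
  exists U => //; exists (exist _ U COU) => // FU'; apply: nU.
  by exists (exist _ U COU).
have [[V1 [V2 [V1op V2op eW neW1 neW2]]] | [x eW]] := sob W Wop WT.
  exfalso.
  have [|U1 sU1 FU1] := larger V1 V1op _ neW1; first by rewrite eW => ? [].
  have [|U2 sU2 FU2] := larger V2 V2op _ neW2; first by rewrite eW => ? [].
  apply: (sWP (U1 `&` U2)%O); last exact: FI.
  by rewrite eW => y [/sU1 ? /sU2 ?].
exists x; apply/seteqP; split=> V; last first.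
  move=> Vx; apply: contrapT => nFV.
  have : W x by exists (sval V) => //; exists V.
  by rewrite eW => /(_ (@subset_closure _ _ x erefl)).
move=> FV; apply: contrapT => nVx; apply: (sWP V) => // y Vy.
rewrite eW => /(_ (sval V)) [].
  by apply: open_nbhs_nbhs; split=> //; exact: (proj2_sig V).1.
by move=> _ [->].
Qed.

Theorem SpecD_LatD : equivalent SpecD (opposite LatD).
Proof.
apply: (@fully_faithful_equivalent _ _ (lattice_functor (S := SpecD_ring)
  SpecD_morph_id SpecD_morph_comp (fun _ _ _ => iff_refl _))).
  apply: lattice_functor_fully_faithful => X Y h [h_hom _] x.
  apply: SpecD_prime_filter_point; apply: bullet_prime h_hom _.
  exact: point_filter_prime.
move=> L; pose Xd : set (spectrum L) := [set F | lat_dec L (spec_ev F)].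
have evXd : @spec_ev _ L @` Xd = lat_dec L.
  apply/seteqP; split=> [_ [F dF <-] // | F dF].
  by exists (exist _ F ((lat_decent L).1 F dF)).
have decX : is_decent_subset Xd.
  rewrite /is_decent_subset CO_spectrum => _ _ [a _ <-] [b _ <-] + eab.
  by apply; rewrite (hat_decent_inj evXd eab).
pose XL := SpecDObj (spectrum_spectral L) decX.
exists XL; apply: (@representation (SpecD_ring XL) L (@spec_ev _ L)) => //.
  exact: spec_ev_prime.
exact: CO_spectrum.
Qed.

Theorem theorem5p4 :
  equivalent SS0 (opposite LatD) /\
  equivalent (opposite LatD) SpecD /\
  equivalent SS0 SpecD.
Proof.
have SpecD_op := equivalent_sym SpecD_LatD.
by split; [|split]; [exact: SS0_LatD | exact: SpecD_op |
  exact: equivalent_trans SS0_LatD SpecD_op].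
Qed.
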